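(* Let $G$ be a DMG, and let $P$ be a DPAG that contains $G$. For two nodes $i\neq j$ in $P$: if there is no possibly directed path from $i$ to $j$ in $P$, then $i\notin\mathrm{an}_G(j)$.
   Context: DMGs. A directed mixed graph (DMG) $G=\langle V,E,F\rangle$ has a finite node set $V$, directed edges $i\to j$ and bidirected edges $i\leftrightarrow j$ between distinct nodes; several edges between two nodes are allowed (at most one of each of $i\to j$, $i\leftarrow j$, $i\leftrightarrow j$). A path is an alternating sequence of nodes and edges, each edge connecting consecutive nodes, containing each node at most once. $\mathrm{an}_G(j)$ is the set of nodes $i$ with a (possibly trivial) directed path $i\to\dots\to j$; $\mathrm{de}_G(i)=\{j:i\in\mathrm{an}_G(j)\}$; the strongly connected component of $i$ is $\mathrm{an}_G(i)\cap\mathrm{de}_G(i)$; $\mathrm{an}_G(I)=\bigcup_{i\in I}\mathrm{an}_G(i)$. A non-endpoint node on a path is a collider if both adjacent path edges have an arrowhead at it; other nodes on it are non-colliders. An inducing path between $i$ and $j$ in a DMG $G$ is a path between them on which every collider is in $\mathrm{an}_G(\{i,j\})$ and each non-endpoint non-collider only has outgoing directed edges (on the path) to neighbouring nodes on the path in the same strongly connected component of $G$. DPAGs. A directed partial ancestral graph (DPAG) is a mixed graph with edges of types $\to,\leftarrow,\leftrightarrow,\circ\!\!\to,\leftarrow\!\!\circ,\circ\!\!-\!\!\circ$, at most one edge between two distinct nodes, no self-cycles, no directed cycle and no almost directed cycle (directed path from $i$ to $j$ together with $j\leftrightarrow i$), and no inducing path between non-adjacent nodes (a path all of whose non-endpoint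 nodes are colliders on it and ancestors, via directed paths, of an endpoint). $*$ stands for any edge mark. A DPAG $P$ contains a DMG $G$ with the same node set if: (1) $i,j$ are adjacent in $P$ iff there is an inducing path between them in $G$; (2) $i\,*\!\!\to j$ in $P$ (i.e. $i\to j$, $i\circ\!\!\to j$ or $i\leftrightarrow j$) implies $j\notin\mathrm{an}_G(i)$; (3) $i\to j$ in $P$ implies $i\in\mathrm{an}_G(j)$. A path $v_0,\dots,v_n$ in $P$ is possibly directed from $v_0$ to $v_n$ if each edge between $v_{m-1}$ and $v_m$ is $v_{m-1}\circ\!\!-\!\!\circ v_m$, $v_{m-1}\circ\!\!\to v_m$ or $v_{m-1}\to v_m$. *)

(* Defs.v *)
From mathcomp Require Import all_boot.

Set Implicit Arguments.
Unset Strict Implicit.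
Unset Printing Implicit Defensive.

Inductive mark := Tail | Arrow | Circle.

(* [edge G i a b j] reads: G has an edge between i and j with mark a at i and
   mark b at j.  As [edge] is a predicate, there is at most one edge of each
   type, but edges of several types may join the same two nodes. *)
Record mixed_graph (V : finType) := MixedGraph {
  edge : V -> mark -> mark -> V -> bool;
  edge_sym : forall i a b j, edge i a b j = edge j b a i;
  edge_irr : forall i a b, edge i a b i = false
}.

Section MixedGraph.
Variables (V : finType) (G : mixed_graph V).

Definition dir (i j : V) : bool := edge G i Tail Arrow j.
Definition bidir (i j : V) : bool := edge G i Arrow Arrow j.
Definition adjacent (i j : V) : Prop := exists a b, edge G i a b j.

Definition an (j : V) : {set V} := [set i | connect dir i j].
Definition de (i : V) : {set V} := [set j | i \in an j].
Definition scc (i : V) : {set V} := an i :&: de i.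
Definition an_set (I : {set V}) : {set V} := \bigcup_(i in I) an i.

(* An alternating sequence of nodes and edges is given by its first node and a
   list of steps (a, b, y): follow an edge with mark a at the current node and
   mark b at y, and move to y. *)
Definition step := (mark * mark * V)%type.

Definition nodes (i : V) (p : seq step) : seq V := i :: [seq s.2 | s <- p].

Fixpoint is_walk (i : V) (p : seq step) : bool :=
  if p is (a, b, y) :: p' then edge G i a b y && is_walk y p' else true.

Definition is_path (i : V) (p : seq step) (j : V) : bool :=
  [&& is_walk i p, uniq (nodes i p) & last i [seq s.2 | s <- p] == j].

(* [triple i p x a b y c d z]: somewhere on the path p starting at i, the node
   y is preceded by x and followed by z; the path edge between x and y has mark
   a at x and b at y, and the one between y and z has mark c at y and d at z.
   Such y are exactly the non-endpoint nodes of the path. *)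
Definition triple (i : V) (p : seq step)
    (x : V) (a b : mark) (y : V) (c d : mark) (z : V) : Prop :=
  exists p1 p2 : seq step,
    p = p1 ++ [:: (a, b, y), (c, d, z) & p2] /\ x = last i [seq s.2 | s <- p1].

Definition collider (b c : mark) : Prop := b = Arrow /\ c = Arrow.

End MixedGraph.

Definition dmg_edge (a b : mark) : bool :=
  match a, b with
  | Tail, Arrow | Arrow, Tail | Arrow, Arrow => true
  | _, _ => false
  end.

Record dmg (V : finType) := DMG {
  dmg_graph :> mixed_graph V;
  dmg_edges : forall i a b j, edge dmg_graph i a b j -> dmg_edge a b
}.

Definition inducing_path (V : finType) (G : dmg V)
    (i : V) (p : seq (step V)) (j : V) : Prop :=
  is_path G i p j /\
  forall x a b y c d z, triple i p x a b y c d z ->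
    (collider b c -> y \in an_set G [set i; j]) /\
    (~ collider b c ->
       (b = Tail /\ a = Arrow -> x \in scc G y) /\
       (c = Tail /\ d = Arrow -> z \in scc G y)).

(* The inducing paths used in the definition of a DPAG, as opposed to those of
   a DMG. *)
Definition ancestral_inducing_path (V : finType) (P : mixed_graph V)
    (i : V) (p : seq (step V)) (j : V) : Prop :=
  is_path P i p j /\
  forall x a b y c d z, triple i p x a b y c d z ->
    collider b c /\ y \in an_set P [set i; j].

Definition dpag_edge (a b : mark) : bool :=
  match a, b with
  | Tail, Arrow | Arrow, Tail | Arrow, Arrow
  | Circle, Arrow | Arrow, Circle | Circle, Circle => true
  | _, _ => false
  end.

Record dpag (V : finType) := DPAG {
  dpag_graph :> mixed_graph V;
  dpag_edges : forall i a b j, edge dpag_graph i a b j -> dpag_edge a b;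
  dpag_simple : forall i a b c d j,
    edge dpag_graph i a b j -> edge dpag_graph i c d j -> a = c /\ b = d;
  dpag_acyclic : forall i j, i \in an dpag_graph j -> ~~ dir dpag_graph j i;
  dpag_almost_acyclic : forall i j,
    i \in an dpag_graph j -> ~~ bidir dpag_graph j i;
  dpag_maximal : forall i p j, i != j ->
    ancestral_inducing_path dpag_graph i p j -> adjacent dpag_graph i j
}.

(* Adjacency is compared on distinct nodes only: the trivial path is an
   inducing path from a node to itself. *)
Definition contains (V : finType) (P : dpag V) (G : dmg V) : Prop :=
  [/\ forall i j, i != j ->
        (adjacent P i j <-> exists p, inducing_path G i p j),
      forall i a j, edge P i a Arrow j -> j \notin an G i
    & forall i j, edge P i Tail Arrow j -> i \in an G j].

Definition possibly_directed_edge (a b : mark) : bool :=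
  match a, b with
  | Circle, Circle | Circle, Arrow | Tail, Arrow => true
  | _, _ => false
  end.

Definition possibly_directed_path (V : finType) (P : dpag V)
    (i : V) (p : seq (step V)) (j : V) : bool :=
  is_path P i p j && all (fun s => possibly_directed_edge s.1.1 s.1.2) p.

(* Main.v *)
Require Import Defs.
From mathcomp Require Import all_boot.

(** A directed path from [i] to [j] in [G] visits nodes that form a possibly
    directed path in [P].  Indeed a single edge [u -> v] of [G] is an inducing
    path, as it has no non-endpoint node, so [u] and [v] are adjacent in [P].
    The mark at [u] of the edge of [P] between them cannot be an arrowhead, for
    that would say that [u] is not an ancestor of [v] in [G]; and every edge of
    a DPAG without an arrowhead at [u] is possibly directed from [u] to [v].
    Ancestry is witnessed by a directed path without repeated nodes, so
    replacing its edges one by one ([possibly_directed_lift]) yields a path and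
    not only a walk. *)

Lemma dir_inducing_path (V : finType) (G : dmg V) (u v : V) :
  dir G u v -> inducing_path G u [:: (Tail, Arrow, v)] v.
Proof.
move=> uv; split.
  rewrite /is_path /= eqxx !andbT inE; apply/andP; split; first exact: uv.
  by apply: contraTneq uv => ->; rewrite /dir edge_irr.
by move=> x a b y c d z [[|s [|s' p1]] [p2 []]].
Qed.

(** The case of a single edge. Its mark at [u] is all that matters: a tail or a
    circle there leaves only the edge types allowed on a possibly directed
    path. *)
Lemma dir_possibly_directed_edge (V : finType) (G : dmg V) (P : dpag V)
    (u v : V) :
  contains P G -> dir G u v ->
  exists a b, edge P u a b v && possibly_directed_edge a b.
Proof.
move=> [adjP arrowP _] uv.
have neq_uv : u != v.
  by apply: contraTneq uv => ->; rewrite /dir edge_irr.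
have [a [b uPv]] : adjacent P u v.
  by apply/(adjP _ _ neq_uv); exists [:: (Tail, Arrow, v)];
    exact: dir_inducing_path.
exists a, b; rewrite uPv /=.
have a_not_arrow : a <> Arrow.
  move=> a_arrow; rewrite edge_sym a_arrow in uPv.
  by move/arrowP: uPv; rewrite inE (connect1 uv).
by move: (dpag_edges uPv) a_not_arrow; case: (a); case: (b).
Qed.

(** The lifted walk visits the very same nodes, which is what transfers
    simplicity and the last node from [G] to [P]. *)
Lemma possibly_directed_lift (V : finType) (G : dmg V) (P : dpag V)
    (i : V) (q : seq V) :
  contains P G -> path (dir G) i q ->
  exists p : seq (step V),
    [/\ is_walk P i p, [seq s.2 | s <- p] = q
      & all (fun s => possibly_directed_edge s.1.1 s.1.2) p].
Proof.
move=> hPG; elim: q i => [|v q IHq] i /=; first by exists [::].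
case/andP=> /(dir_possibly_directed_edge _ _ _ _ _ hPG) [a [b /andP[iPv ab]]].
move=> /IHq [p [walk_p nodes_p pd_p]].
by exists ((a, b, v) :: p); split; rewrite /= ?iPv ?nodes_p ?ab.
Qed.

Theorem proposition5 (V : finType) (G : dmg V) (P : dpag V)
    (hPG : contains P G) (i j : V) (hij : i != j) :
  ~ (exists p : seq (step V), possibly_directed_path P i p j) ->
  i \notin an G j.
Proof.
move=> no_path; apply/negP; rewrite inE => /connectP [q0 path_q0 last_q0].
apply: no_path.
case/shortenP: path_q0 last_q0 => q path_q uniq_q _ last_q.
have [p [walk_p nodes_p pd_p]] := possibly_directed_lift _ _ _ _ _ hPG path_q.
exists p; rewrite /possibly_directed_path /is_path /nodes nodes_p.
by rewrite walk_p uniq_q pd_p -last_q eqxx.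
Qed.
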